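(* Let $F$ be a field, $m\ge2$, and let $A=F\langle x_1,\dots,x_m\rangle/I$ be a monomial algebra. Then \[\varprojlim\mathcal P(A)=\bigcup_{\substack{\mathcal T=C_0C_1\cdots\\ \text{tree over }A}} i(C_0)\times i(C_1)\times\cdots .\] Equivalently, for every $n\ge0$, \[\mathcal P_n(A)=\bigcup_{\substack{\mathcal T=C_0C_1\cdots\\ \text{tree over }A}} i(C_0)\times i(C_1)\times\cdots\times i(C_n).\] Similarly, $\overline{\mathcal P}_n(A)$ is the union of all the sets $i(C_0)\times\cdots\times i(C_n)$, where $C_0,\dots,C_n$ are non-empty subsets of $\{x_1,\dots,x_m\}$ such that all of the monomials in $C_0\cdots C_n$ are non-zero in $A$.
   Context: A monomial algebra is a quotient of a free associative algebra $F\langle x_1,\dots,x_m\rangle$ by an ideal generated by monomials, graded by $\deg x_i=1$. Let $\Sigma=\{x_1,\dots,x_m\}$. For non-empty $C\subseteq\Sigma$, $i(C)=\{[w_0:\cdots:w_{m-1}]\in\mathbb P^{m-1} : w_{k-1}=0 \text{ for all } k \text{ with } x_k\notin C\}$; so $i(\{x_k\})$ is the $k$-th coordinate point. For non-empty subsets $C_0,C_1,\dots\subseteq\Sigma$, the set of infinite words $\mathcal T=C_0C_1\cdots$ (all words $y_0y_1\cdots$ with $y_i\in C_i$) is a tree over $A$ if every finite factor of every word in $\mathcal T$ is a non-zero monomial in $A$. A point module is a graded cyclic right $A$-module $P=\bigoplus_{n\ge0}P_n$ generated in degree $0$ with all $\dim_F P_n=1$. Writing $P_i=Fe_i$, $e_i\cdot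 x_j=\lambda_{i,j}e_{i+1}$, its isomorphism class is recorded by $(\underline\lambda_0,\underline\lambda_1,\dots)\in\mathbb P^{m-1}\times\mathbb P^{m-1}\times\cdots$, $\underline\lambda_i=[\lambda_{i,1}:\cdots:\lambda_{i,m}]$. The set of all such sequences is $\varprojlim\mathcal P(A)$, and $\mathcal P_n(A)\subseteq(\mathbb P^{m-1})^{\times(n+1)}$ is its projection to the first $n+1$ factors. $\overline{\mathcal P}_n(A)\subseteq(\mathbb P^{m-1})^{\times(n+1)}$ is the set of $(\underline\lambda_0,\dots,\underline\lambda_n)$ arising in the same way from graded cyclic right $A$-modules $M=Fe_0+\cdots+Fe_{n+1}$ generated by $e_0$ in degree $0$, with one-dimensional components exactly in degrees $0,\dots,n+1$, via $e_i\cdot x_j=\lambda_{i,j}e_{i+1}$. *)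

(* Defs.v *)
From HB Require Import structures.
From mathcomp Require Import all_boot all_algebra.
From mathcomp Require Import generic_quotient ring_quotient.
From mathcomp Require Import boolp classical_sets.
From mathcomp Require Import monalg.

Set Implicit Arguments.
Unset Strict Implicit.
Unset Printing Implicit Defensive.

Import GRing.Theory.

Local Open Scope classical_set_scope.
Local Open Scope ring_scope.
Local Open Scope quotient_scope.

(* The generator x_k (1 <= k <= m) is the letter k - 1 : 'I_m.   *)
Notation free_alg F m := {malg F[{fmonom 'I_m}]}.

Section MonomialAlgebra.
Variables (F : fieldType) (m : nat).

Definition two_sided_ideal (J : set (free_alg F m)) : Prop :=
  [/\ J 0,
      forall f g, J f -> J g -> J (f - g),
      forall f g, J f -> J (g * f)
    & forall f g, J f -> J (f * g)].

Definition monomial_ideal (S : set {fmonom 'I_m}) : set (free_alg F m) :=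
  [set f | forall J : set (free_alg F m), two_sided_ideal J ->
     (forall w, S w -> J << w >>) -> J f].

Lemma monomial_idealP (S : set {fmonom 'I_m}) :
  two_sided_ideal (monomial_ideal S).
Proof.
split=> [J [] //|f g If Ig J HJ HS|f g If J HJ HS|f g If J HJ HS].
- by case: (HJ) => _ HB _ _; exact: HB (If J HJ HS) (Ig J HJ HS).
- by case: (HJ) => _ _ HM _; exact: HM (If J HJ HS).
- by case: (HJ) => _ _ _ HM; exact: HM (If J HJ HS).
Qed.

Definition monomial_ideal_pred (S : set {fmonom 'I_m}) : pred (free_alg F m) :=
  fun f => `[< monomial_ideal S f >].

Lemma monomial_ideal_zmod_closed (S : set {fmonom 'I_m}) :
  zmod_closed (monomial_ideal_pred S).
Proof.
case: (monomial_idealP S) => I0 IB _ _; split.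
  by rewrite unfold_in; apply/asboolP.
move=> f g; rewrite !unfold_in => /asboolP If /asboolP Ig.
by apply/asboolP; exact: IB If Ig.
Qed.

HB.instance Definition _ (S : set {fmonom 'I_m}) :=
  GRing.isZmodClosed.Build (free_alg F m) (monomial_ideal_pred S)
    (monomial_ideal_zmod_closed S).

Definition monomial_ideal_zmod (S : set {fmonom 'I_m}) :
    zmodClosed (free_alg F m) :=
  GRing.ZmodClosed.clone _ (monomial_ideal_pred S) _.

(* Any S is allowed, so the quotient may be the zero ring: hence pzRingType.  *)
Definition monomial_alg (S : set {fmonom 'I_m}) : Type :=
  Quotient.quot (monomial_ideal_zmod S).

Section Quotient.
Variable S : set {fmonom 'I_m}.
Local Notation A := (monomial_alg S).

HB.instance Definition _ := GRing.Zmodule.on A.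

Definition alg_proj (f : free_alg F m) : A :=
  \pi_(Quotient.quot (monomial_ideal_zmod S)) f.
Definition alg_repr (a : A) : free_alg F m :=
  repr (a : Quotient.quot (monomial_ideal_zmod S)).

Lemma alg_reprK a : alg_proj (alg_repr a) = a.
Proof. exact: reprK. Qed.

Lemma alg_proj_eq f g : (alg_proj f = alg_proj g) <-> monomial_ideal S (f - g).
Proof.
split=> [/eqP|H]; first by rewrite -Quotient.idealrBE => /asboolP.
by apply/eqP; rewrite -Quotient.idealrBE; apply/asboolP.
Qed.

Lemma alg_projD : {morph alg_proj : f g / f + g}.
Proof. by move=> f g; rewrite /alg_proj !piE. Qed.

Lemma alg_repr_proj f : monomial_ideal S (alg_repr (alg_proj f) - f).
Proof. by apply/alg_proj_eq; rewrite alg_reprK. Qed.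

Definition alg_one : A := alg_proj 1.
Definition alg_mul (a b : A) : A := alg_proj (alg_repr a * alg_repr b).
Definition alg_scale (c : F) (a : A) : A := alg_proj (c *: alg_repr a).

Lemma monomial_idealD f g :
  monomial_ideal S f -> monomial_ideal S g -> monomial_ideal S (f + g).
Proof.
case: (monomial_idealP S) => I0 IB _ _ If Ig.
by rewrite -[g]opprK; apply: (IB _ _ If); rewrite -sub0r; apply: IB.
Qed.

Lemma monomial_idealZ c f : monomial_ideal S f -> monomial_ideal S (c *: f).
Proof.
case: (monomial_idealP S) => _ _ IM _ If.
by rewrite -[f]mul1r scalerAl; apply: IM.
Qed.

Lemma alg_projM : {morph alg_proj : f g / f * g >-> alg_mul f g}.
Proof.
move=> f g; apply/esym/alg_proj_eq.
set f' := alg_repr _; set g' := alg_repr _.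
have -> : f' * g' - f * g = (f' - f) * g' + f * (g' - g).
  by rewrite mulrBl mulrBr addrA subrK.
case: (monomial_idealP S) => _ _ IMl IMr.
apply: monomial_idealD.
  exact: IMr (alg_repr_proj f).
exact: IMl (alg_repr_proj g).
Qed.

Lemma alg_projZ c : {morph alg_proj : f / c *: f >-> alg_scale c f}.
Proof.
move=> f; apply/esym/alg_proj_eq; rewrite -scalerBr.
exact: monomial_idealZ (alg_repr_proj f).
Qed.

Lemma alg_mulA : associative alg_mul.
Proof.
move=> a b c; rewrite -[a]alg_reprK -[b]alg_reprK -[c]alg_reprK.
by rewrite -!alg_projM mulrA.
Qed.

Lemma alg_mul1l : left_id alg_one alg_mul.
Proof. by move=> a; rewrite -[a]alg_reprK -alg_projM mul1r. Qed.

Lemma alg_mul1r : right_id alg_one alg_mul.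
Proof. by move=> a; rewrite -[a]alg_reprK -alg_projM mulr1. Qed.

Lemma alg_mulDl : left_distributive alg_mul +%R.
Proof.
move=> a b c; rewrite -[a]alg_reprK -[b]alg_reprK -[c]alg_reprK.
by rewrite -alg_projD -!alg_projM -alg_projD mulrDl.
Qed.

Lemma alg_mulDr : right_distributive alg_mul +%R.
Proof.
move=> a b c; rewrite -[a]alg_reprK -[b]alg_reprK -[c]alg_reprK.
by rewrite -alg_projD -!alg_projM -alg_projD mulrDr.
Qed.

HB.instance Definition _ := GRing.Zmodule_isPzRing.Build A
  alg_mulA alg_mul1l alg_mul1r alg_mulDl alg_mulDr.

Lemma alg_scaleA a b (v : A) : alg_scale a (alg_scale b v) = alg_scale (a * b) v.
Proof. by rewrite -[v]alg_reprK -!alg_projZ scalerA. Qed.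

Lemma alg_scale1 : left_id 1 alg_scale.
Proof. by move=> v; rewrite -[v]alg_reprK -alg_projZ scale1r. Qed.

Lemma alg_scaleDr : right_distributive alg_scale +%R.
Proof.
move=> c a b; rewrite -[a]alg_reprK -[b]alg_reprK.
by rewrite -alg_projD -!alg_projZ -alg_projD scalerDr.
Qed.

Lemma alg_scaleDl (v : A) : {morph alg_scale^~ v : a b / a + b}.
Proof.
by move=> a b; rewrite -[v]alg_reprK -!alg_projZ -alg_projD scalerDl.
Qed.

HB.instance Definition _ := GRing.Zmodule_isLmodule.Build F A
  alg_scaleA alg_scale1 alg_scaleDr alg_scaleDl.

Definition mono (w : seq 'I_m) : A := alg_proj << FMonom w >>.

Definition gen (j : 'I_m) : A := mono [:: j].

(* A_n for the grading with all generators in degree 1.                       *)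
Definition alg_comp (n : nat) : set A :=
  [set alg_proj f | f in
     [set f : free_alg F m | forall w, f@_w != 0 -> fdeg w = n]].

End Quotient.
End MonomialAlgebra.

Arguments alg_proj F {m} S f.
Arguments mono F {m} S w.
Arguments gen F {m} S j.
Arguments alg_comp F {m} S n _.

Section Modules.
Variables (F : fieldType) (m : nat) (S : set {fmonom 'I_m}).
Local Notation A := (monomial_alg F S).

(* A right A-module is a left module over the converse ring A^c.              *)
Definition ract (M : lmodType A^c) (u : M) (a : A) : M := (a : A^c) *: u.

(* The F-vector space structure of an A-module.                               *)
Definition fscale (M : lmodType A^c) (c : F) (u : M) : M :=
  ract u (c *: (1 : A)).

Record graded_module := GradedModule {
  gm_sort :> lmodType A^c;
  gm_comp : nat -> set gm_sort;
  gm_comp0 : forall n, gm_comp n 0;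
  gm_compD : forall n u v, gm_comp n u -> gm_comp n v -> gm_comp n (u + v);
  gm_compZ : forall n c u, gm_comp n u -> gm_comp n (fscale c u);
  gm_comp_sum : forall u, exists N (v : nat -> gm_sort),
    (forall i, gm_comp i (v i)) /\ u = \sum_(i < N) v i;
  gm_comp_direct : forall N (v : nat -> gm_sort),
    (forall i, gm_comp i (v i)) -> \sum_(i < N) v i = 0 ->
    forall i, (i < N)%N -> v i = 0;
  gm_comp_act : forall i j u a,
    gm_comp i u -> alg_comp F S j a -> gm_comp (i + j)%N (ract u a)
}.

Arguments gm_comp : clear implicits.

Definition spans_line (M : lmodType A^c) (V : set M) (e : M) : Prop :=
  e != 0 /\ V = [set fscale c e | c in [set: F]].

Definition dim1 (M : lmodType A^c) (V : set M) : Prop :=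
  exists e, spans_line V e.

Definition cyclic_deg0 (M : graded_module) : Prop :=
  exists2 v : M, gm_comp M 0%N v & forall u : M, exists a : A, u = ract v a.

Definition point_module (M : graded_module) : Prop :=
  cyclic_deg0 M /\ forall n, dim1 (gm_comp M n).

Definition truncated_point_module (n : nat) (M : graded_module) : Prop :=
  [/\ cyclic_deg0 M,
      forall k, (k <= n.+1)%N -> dim1 (gm_comp M k)
    & forall k, (n.+1 < k)%N -> gm_comp M k = [set 0]].

End Modules.

Arguments gm_comp {F m S} g n _.

(* P^(m-1)(F): the lines of F^m.                                              *)
Definition proj_space (F : fieldType) (m : nat) : Type :=
  {L : {vspace 'rV[F]_m} | \dim L == 1%N}.

(* p = [w_0 : ... : w_(m-1)]; as \dim (\val p) = 1, this forces w != 0.       *)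
Definition homog_coords (F : fieldType) (m : nat)
    (p : proj_space F m) (w : 'rV[F]_m) : Prop :=
  \val p = <[w]>%VS.

Definition coord_subspace (F : fieldType) (m : nat) (C : {set 'I_m}) :
    set (proj_space F m) :=
  [set p | exists2 w, homog_coords p w & forall k, k \notin C -> w 0 k = 0].

Arguments coord_subspace F {m} C _.

Section PointModules.
Variables (F : fieldType) (m : nat) (S : set {fmonom 'I_m}).

Definition limP : set (nat -> proj_space F m) :=
  [set p | exists M : graded_module F S, point_module M /\
     exists (e : nat -> M) (lam : nat -> 'rV[F]_m),
     [/\ forall i, spans_line (gm_comp M i) (e i),
         forall i j, ract (e i) (gen F S j) = fscale (lam i 0 j) (e i.+1)
       & forall i, homog_coords (p i) (lam i)]].

Definition truncP (n : nat) : set ('I_n.+1 -> proj_space F m) :=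
  [set (fun i : 'I_n.+1 => p i) | p in limP].

Definition barP (n : nat) : set ('I_n.+1 -> proj_space F m) :=
  [set p | exists M : graded_module F S, truncated_point_module n M /\
     exists (e : nat -> M) (lam : 'I_n.+1 -> 'rV[F]_m),
     [/\ forall i, (i <= n.+1)%N -> spans_line (gm_comp M i) (e i),
         forall (i : 'I_n.+1) j,
           ract (e i) (gen F S j) = fscale (lam i 0 j) (e i.+1)
       & forall i, homog_coords (p i) (lam i)]].

Definition infinite_words (C : nat -> {set 'I_m}) : set (nat -> 'I_m) :=
  [set y | forall i, y i \in C i].

Definition factor (y : nat -> 'I_m) (s l : nat) : seq 'I_m :=
  [seq y k | k <- iota s l].

Definition is_tree (C : nat -> {set 'I_m}) : Prop :=
  (forall k, C k != finset.set0) /\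
  forall y, infinite_words C y -> forall s l, mono F S (factor y s l) != 0.

Definition nonzero_product (n : nat) (C : 'I_n.+1 -> {set 'I_m}) : Prop :=
  (forall k, C k != finset.set0) /\
  forall w : n.+1.-tuple 'I_m,
    (forall k, tnth w k \in C k) -> mono F S w != 0.

End PointModules.

Arguments limP F {m} S _.
Arguments truncP F {m} S n _.
Arguments barP F {m} S n _.
Arguments is_tree F {m} S C.
Arguments nonzero_product F {m} S {n} C.

(* Main.v *)
(** The e_i of a (truncated) point module are nonzero, so along a word y with
    every lambda_{i, y_i} nonzero the monomial y acts by a nonzero scalar and
    is nonzero in A: the supports C_i of the lambda_i form a tree.
    Conversely, given lambda_i supported in C_i, put e_i = X^i in F[X] (or in
    the polynomials of degree at most n + 1) and let x_j send X^i to
    lambda_{i,j} X^(i+1).  A word acting nontrivially there is a factor of a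
    word of C_0 C_1 ..., hence is not a relation, so this is an A-module. *)
Require Import Defs.
From HB Require Import structures.
From mathcomp Require Import all_boot all_algebra.
From mathcomp Require Import boolp classical_sets.
From mathcomp Require Import finmap monalg.
Set Implicit Arguments.
Unset Strict Implicit.
Unset Printing Implicit Defensive.

Import GRing.Theory.
Local Open Scope classical_set_scope.
Local Open Scope ring_scope.

(** * Words and scalars in a monomial algebra, and their action on right modules *)

Section MonomialAlgebraTheory.
Variables (F : fieldType) (m : nat) (S : set {fmonom 'I_m}).
Local Notation A := (monomial_alg F S).
Implicit Types (f g : free_alg F m) (a : A) (c : F) (w : seq 'I_m).

Lemma fmonom_nil : (mone : {fmonom 'I_m}) = FMonom [::].
Proof. by apply: val_inj; rewrite /= fm1. Qed.

Lemma malg_mulU1 f c : f * << c *g FMonom [::] >> = c *: f.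
Proof.
rewrite malgM_def fgmulgU malgZ_def /fgscale.
by apply: eq_bigr => k _; rewrite -fmonom_nil mulrC mulm1.
Qed.

Lemma malg_scale1 c : c *: 1 = << c *g FMonom [::] >> :> free_alg F m.
Proof. by rewrite -malg_mulU1 mul1r. Qed.

Lemma fmonom_cat w w' : mmul (FMonom w) (FMonom w') = FMonom (w ++ w').
Proof. by apply: val_inj; rewrite /= fmM. Qed.

Lemma malgUM w w' :
  << FMonom w >> * << FMonom w' >> = << FMonom (w ++ w') >> :> free_alg F m.
Proof. by rewrite malgM_def fgmulUU mulr1 fmonom_cat. Qed.

Lemma mono_cat w w' : mono F S (w ++ w') = mono F S w * mono F S w'.
Proof. by rewrite /mono -malgUM alg_projM. Qed.

Lemma mono_nil : mono F S [::] = 1.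
Proof. by rewrite /mono -fmonom_nil. Qed.

(** A zero factor makes the whole product zero. This reduces the case of short words to words of
    full length. *)
Lemma mono_infix w1 w w2 : mono F S (w1 ++ w ++ w2) != 0 -> mono F S w != 0.
Proof. by apply: contra_neq => w0; rewrite !mono_cat w0 mul0r mulr0. Qed.

Lemma mono_eq0 (w : {fmonom 'I_m}) : S w -> mono F S w = 0.
Proof.
case: w => w Sw; have <- : alg_proj F S (0 : free_alg F m) = 0.
  by apply/(addrI (alg_proj F S 0)); rewrite -alg_projD !addr0.
by apply/alg_proj_eq; rewrite subr0 => J _; apply.
Qed.

Lemma alg_projZ1 c : c *: (1 : A) = alg_proj F S << c *g FMonom [::] >>.
Proof. by rewrite -malg_scale1 alg_projZ. Qed.

(** Together with [mul_Z1alg], this makes the scalars central in [A], so that the action of [A] on a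
    module commutes with [fscale]. *)
Lemma mul_algZ1 a c : a * (c *: (1 : A)) = c *: a.
Proof.
rewrite alg_projZ1 -[a]alg_reprK.
by rewrite -[LHS]alg_projM -[RHS]alg_projZ malg_mulU1.
Qed.

Lemma mul_Z1alg a c : (c *: (1 : A)) * a = c *: a.
Proof.
rewrite alg_projZ1 -[a]alg_reprK.
by rewrite -[LHS]alg_projM -[RHS]alg_projZ -fmonom_nil mul_malgC.
Qed.

Variable M : lmodType A^c.
Implicit Types (u v : M).

Lemma ractM u a (b : A) : ract u (a * b) = ract (ract u a) b.
Proof. by rewrite /ract scalerA. Qed.

Lemma ract1 u : ract u 1 = u.
Proof. exact: scale1r. Qed.

Lemma ract_fscale c u a : ract (fscale c u) a = fscale c (ract u a).
Proof. by rewrite /fscale -!ractM mul_algZ1 mul_Z1alg. Qed.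

Lemma fscaleA c d u : fscale c (fscale d u) = fscale (c * d) u.
Proof. by rewrite /fscale -ractM mul_Z1alg scalerA mulrC. Qed.

Lemma fscale1 u : fscale (1 : F) u = u.
Proof. by rewrite /fscale scale1r ract1. Qed.

Lemma fscale_eq0 c u : c != 0 -> u != 0 -> fscale c u != 0.
Proof.
move=> c0; apply: contra_neq => cu0.
by rewrite -[u]fscale1 -(mulVf c0) -fscaleA cu0 /fscale /ract scaler0.
Qed.

Lemma fscale_inv c u v : c != 0 -> v = fscale c u -> u = fscale c^-1 v.
Proof. by move=> c0 ->; rewrite fscaleA mulVf ?fscale1. Qed.

Lemma factorS (y : nat -> 'I_m) s l : factor y s l.+1 = y s :: factor y s.+1 l.
Proof. by []. Qed.

Lemma mono_cons j w : mono F S (j :: w) = gen F S j * mono F S w.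
Proof. exact: mono_cat [:: j] w. Qed.

Section Path.
Variables (D : pred nat) (e : nat -> M) (lam : nat -> 'rV[F]_m).
Hypothesis e_gen : forall i j, D i.+1 ->
  ract (e i) (gen F S j) = fscale (lam i 0 j) (e i.+1).
Variable y : nat -> 'I_m.
Hypothesis lam_y : forall i, D i.+1 -> lam i 0 (y i) != 0.

(** Each letter of [y] sends e_i to a nonzero multiple of e_(i+1), so the scalar is the product of
    the lambda_{i, y_i} for s <= i < s + l. The predicate [D] marks the degrees at hand: all of them
    for point modules, those up to n + 1 for truncated ones. *)
Lemma ract_path s l : (forall k, (k <= s + l)%N -> D k) ->
  exists2 c : F, c != 0 &
    ract (e s) (mono F S (factor y s l)) = fscale c (e (s + l)%N).
Proof.
elim: l s => [|l IHl] s Ds.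
  by exists 1; rewrite ?oner_eq0 // mono_nil ract1 fscale1 addn0.
have DS : D s.+1 by apply: Ds; rewrite addnS ltnS leq_addr.
have [|c c0 Ec] := IHl s.+1; first by rewrite addSnnS.
exists (lam s 0 (y s) * c); first by rewrite mulf_neq0 ?lam_y.
by rewrite factorS mono_cons ractM e_gen // ract_fscale Ec fscaleA addSnnS.
Qed.

Lemma path_neq0 s l : (forall k, (k <= s + l)%N -> D k) ->
  e (s + l)%N != 0 -> mono F S (factor y s l) != 0.
Proof.
move=> Ds e0; have [c c0 Ec] := ract_path Ds.
apply: contra_neq (fscale_eq0 c0 e0) => w0.
by rewrite -Ec w0 /ract scale0r.
Qed.

End Path.
End MonomialAlgebraTheory.

(** * The free algebra acting through linear operators *)

Section WordAction.
Variables (F : fieldType) (m : nat) (V : lmodType F).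
Variable T : 'I_m -> {linear V -> V}.
Implicit Types (f g : free_alg F m) (u v : V) (w : seq 'I_m).

Definition word_act w v : V := foldl (fun u j => T j u) v w.

Lemma word_act_linear w : linear (word_act w).
Proof.
by elim: w => [|j w IHw] c u v //=; rewrite linearP IHw.
Qed.

HB.instance Definition _ w :=
  GRing.isLinear.Build F V V _ (word_act w) (word_act_linear w).

Definition malg_act f v : V := \sum_(k <- msupp f) f@_k *: word_act k v.

(** Summing over any finite set that contains the support allows several elements to be compared
    over one index set. *)
Lemma malg_actEw (d : {fset {fmonom 'I_m}}) f v : (msupp f `<=` d)%fset ->
  malg_act f v = \sum_(k <- d) f@_k *: word_act k v.
Proof.
move=> le_fd; apply: big_fset_incl => // k _ /mcoeff_outdom ->.
by rewrite scale0r.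
Qed.

Lemma malg_act_linear f : linear (malg_act f).
Proof.
move=> c u v; rewrite /malg_act scaler_sumr -big_split /=.
apply: eq_bigr => k _; rewrite linearP scalerDr !scalerA; congr (_ *: _ + _).
by rewrite mulrC.
Qed.

HB.instance Definition _ f :=
  GRing.isLinear.Build F V V _ (malg_act f) (malg_act_linear f).

Lemma malg_act_linearl v : linear (malg_act^~ v).
Proof.
move=> c f g; pose d := (msupp f `|` msupp g `|` msupp (c *: f + g))%fset.
have sf : (msupp f `<=` d)%fset by rewrite /d -fsetUA fsubsetUl.
have sg : (msupp g `<=` d)%fset by rewrite /d -fsetUA fsubsetU // fsubsetUl orbT.
rewrite (malg_actEw v sf) (malg_actEw v sg) (@malg_actEw d _ v (fsubsetUr _ _)).
rewrite scaler_sumr -big_split; apply: eq_bigr => k _ /=.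
by rewrite mcoeffD mcoeffZ scalerDl scalerA.
Qed.

Lemma malg_actD f g v : malg_act (f + g) v = malg_act f v + malg_act g v.
Proof. by have := malg_act_linearl v 1 f g; rewrite /= !scale1r. Qed.

Lemma malg_act0 v : malg_act 0 v = 0.
Proof. by rewrite /malg_act msupp0 big_seq_fset0. Qed.

Lemma malg_actZ c f v : malg_act (c *: f) v = c *: malg_act f v.
Proof. by have := malg_act_linearl v c f 0; rewrite /= malg_act0 !addr0. Qed.

Lemma malg_actB f g v : malg_act (f - g) v = malg_act f v - malg_act g v.
Proof. by rewrite malg_actD -(scaleN1r g) malg_actZ scaleN1r. Qed.

Lemma malg_act_sum I (r : seq I) (E : I -> free_alg F m) v :
  malg_act (\sum_(i <- r) E i) v = \sum_(i <- r) malg_act (E i) v.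
Proof.
exact: (big_morph (malg_act^~ v) (fun f g => malg_actD f g v) (malg_act0 v)).
Qed.

Lemma malg_actU c (k : {fmonom 'I_m}) v :
  malg_act << c *g k >> v = c *: word_act k v.
Proof. by rewrite (malg_actEw _ msuppU_le) big_seq_fset1 mcoeffUU. Qed.

(** The left factor acts first, because [word_act] applies the letters from left to right: this is a
    right action. *)
Lemma malg_actM f g v : malg_act (f * g) v = malg_act g (malg_act f v).
Proof.
rewrite malgME malg_act_sum [malg_act f v]/malg_act linear_sum; apply: eq_bigr => k _.
rewrite malg_act_sum linearZ /= [malg_act g _]/malg_act scaler_sumr.
apply: eq_bigr => l _; rewrite malg_actU scalerA fmM; congr (_ *: _).
exact: foldl_cat.
Qed.

Lemma malg_act1 v : malg_act 1 v = v.
Proof. by rewrite malg_actU scale1r fm1. Qed.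

Variable S : set {fmonom 'I_m}.

(** Under this condition the action descends from the free algebra to the quotient. *)
Definition words_kill := forall w : {fmonom 'I_m}, S w -> word_act w =1 fun=> 0.

Hypothesis killS : words_kill.

(** The elements that act as zero on all of [V] form a two-sided ideal containing the defining
    monomials, hence containing the ideal they generate. *)
Lemma monomial_ideal_act f v : monomial_ideal S f -> malg_act f v = 0.
Proof.
pose J := [set f : free_alg F m | forall v, malg_act f v = 0].
move=> If; apply: (If J) => [|w Sw u]; last first.
  by rewrite malg_actU killS ?scaler0.
split=> [u|f1 f2 J1 J2 u|f1 f2 J1 u|f1 f2 J1 u].
- by rewrite malg_act0.
- by rewrite malg_actB J1 J2 subr0.
- by rewrite malg_actM J1.
- by rewrite malg_actM J1 linear0.
Qed.

End WordAction.

(** * The induced module over the monomial algebra *)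

Section WordModule.
Variables (F : fieldType) (m : nat) (S : set {fmonom 'I_m}) (V : lmodType F).
Variables (T : 'I_m -> {linear V -> V}) (killS : words_kill T S).
Local Notation A := (monomial_alg F S).
Implicit Types (a b : A) (f : free_alg F m).

(* The dummy [let] records [killS], and so S, in the type to which the A-module
   structure is attached. *)
Definition word_module : Type := let _ := killS in V.
HB.instance Definition _ := GRing.Zmodule.on word_module.
Implicit Types (u v : word_module).

Definition quot_act (a : A^c) v : word_module := malg_act T (alg_repr a) v.

(** The chosen representative differs from [f] by an element of the ideal, which acts as zero; so
    the action does not depend on the choice. *)
Lemma quot_act_proj f v : quot_act (alg_proj F S f) v = malg_act T f v.
Proof.
apply/eqP; rewrite -subr_eq0 -[X in X == _](malg_actB T _ f); apply/eqP.
exact: (monomial_ideal_act killS v (alg_repr_proj f)).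
Qed.

Lemma quot_actA (a b : A^c) v : quot_act a (quot_act b v) = quot_act (a * b) v.
Proof.
(* Multiplication in the converse ring [A^c] swaps the factors. *)
rewrite [a * b](_ : _ = alg_proj F S (alg_repr b * alg_repr a)) //.
by rewrite quot_act_proj malg_actM.
Qed.

Lemma quot_act1 : left_id (1 : A^c) quot_act.
Proof. by move=> v; rewrite quot_act_proj malg_act1. Qed.

Lemma quot_actDr : right_distributive quot_act +%R.
Proof. by move=> a u v; apply: linearD. Qed.

Lemma quot_actDl v : {morph quot_act^~ v : a b / a + b}.
Proof.
move=> a b; rewrite -[in LHS](alg_reprK a) -[in LHS](alg_reprK b) -alg_projD.
by rewrite quot_act_proj malg_actD.
Qed.

HB.instance Definition _ := GRing.Zmodule_isLmodule.Build A^c word_module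
  quot_actA quot_act1 quot_actDr quot_actDl.

Lemma ract_proj (v : word_module) f : ract v (alg_proj F S f) = malg_act T f v.
Proof. exact: quot_act_proj. Qed.

Lemma ract_gen (v : word_module) j : ract v (gen F S j) = T j v.
Proof. by rewrite ract_proj malg_actU scale1r. Qed.

Lemma fscaleE c (v : word_module) : fscale c v = c *: (v : V).
Proof. by rewrite /fscale alg_projZ1 ract_proj malg_actU. Qed.

End WordModule.

(** * Polynomials supported in prescribed degrees *)

Section SupportedPoly.
Variables (F : fieldType) (D : pred nat).

(** One carrier serves both kinds of module: [D] true everywhere gives F[X], and i <= n + 1 gives
    the polynomials of degree at most n + 1. *)
Definition supported : {pred {poly F}} :=
  fun p => `[< forall i, ~~ D i -> p`_i = 0 >].

Lemma supportedP (p : {poly F}) :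
  reflect (forall i, ~~ D i -> p`_i = 0) (p \in supported).
Proof. exact: asboolP. Qed.

Lemma supported_submod : submod_closed supported.
Proof.
split=> [|c p q /supportedP Dp /supportedP Dq]; apply/supportedP => i Di.
  exact: coef0.
by rewrite coefD coefZ Dp ?Dq ?mulr0 ?addr0.
Qed.

HB.instance Definition _ :=
  GRing.isSubmodClosed.Build F {poly F} supported supported_submod.

Record supp_poly := SuppPoly { supp_val :> {poly F}; _ : supp_val \in supported }.

HB.instance Definition _ := [isSub for supp_val].
HB.instance Definition _ := [Choice of supp_poly by <:].
HB.instance Definition _ := [SubChoice_isSubLmodule of supp_poly by <:].

Lemma supp_coef0 (u : supp_poly) i : ~~ D i -> u`_i = 0.
Proof. by move=> Di; have /supportedP/(_ i Di) := valP u. Qed.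

Lemma supp_polyP (u v : supp_poly) : (forall i, u`_i = v`_i) -> u = v.
Proof. by move=> uv; apply/val_inj/polyP. Qed.

(** The default 0 matters: outside [D] the basis vector vanishes, which ends a truncated module
    after its top degree. *)
Definition supp_mon i : supp_poly := insubd 0 'X^i.

Lemma coef_supp_mon i k : (supp_mon i)`_k = (D i && (k == i))%:R.
Proof.
have XD : ('X^i \in supported) = D i.
  apply/supportedP/idP => [Xi|Di l Dl].
    by apply: contraT => /Xi/eqP; rewrite coefXn eqxx oner_eq0.
  by rewrite coefXn; case: eqP Dl => // ->; rewrite Di.
by rewrite [supp_val _]val_insubd XD; case: (D i); rewrite ?coefXn ?coef0.
Qed.

Lemma supp_polyE (u : supp_poly) : u = \sum_(i < size u) u`_i *: supp_mon i.
Proof.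
apply/supp_polyP => k; rewrite -[supp_val (\sum_(i < _) _)]/(val _) linear_sum.
rewrite coef_sum (eq_bigr (fun i : 'I_(size u) => u`_i *+ (k == i))); last first.
  move=> i _; rewrite linearZ coefZ [X in _ * X]coef_supp_mon -[RHS]mulr_natr.
  by have [//|Di] := boolP (D i); rewrite (supp_coef0 u Di) !mul0r.
case: (ltnP k (size u)) => ku.
  rewrite (bigD1 (Ordinal ku)) //= eqxx big1 ?addr0 // => i.
  by rewrite -val_eqE /= eq_sym => /negPf->.
rewrite nth_default // big1 // => i _; case: eqP => // ki.
by move: ku; rewrite ki leqNgt ltn_ord.
Qed.

End SupportedPoly.

(** * The graded module attached to a sequence of coordinate vectors *)

Section PathModule.
Variables (F : fieldType) (m : nat) (S : set {fmonom 'I_m}).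
Variables (D : pred nat) (lam : nat -> 'rV[F]_m).
Hypothesis D_pred : forall i, D i.+1 -> D i.
Hypothesis lam0 : forall i, ~~ D i.+1 -> lam i = 0.
(** Along such a word every step into a degree of [D] has a nonzero scalar. Below, [y0] provides
    cyclicity, and [mono_compatible] ensures that the relations act as zero. *)
Definition compatible (y : nat -> 'I_m) := forall i, D i.+1 -> lam i 0 (y i) != 0.
Variable y0 : nat -> 'I_m.
Hypothesis y0P : compatible y0.
Hypothesis mono_compatible : forall y, compatible y ->
  forall s l, D (s + l)%N -> mono F S (factor y s l) != 0.
Local Notation V := (supp_poly F D).
Implicit Types (u v : V) (i j k n : nat) (x : 'I_m).

Definition shift_poly x (p : {poly F}) : {poly F} :=
  'X * \poly_(i < size p) (p`_i * lam i 0 x).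

Lemma coef_shift x p i :
  (shift_poly x p)`_i = if i is k.+1 then p`_k * lam k 0 x else 0.
Proof.
case: i => [|k]; rewrite coefXM //= coef_poly.
by case: ltnP => // pk; rewrite nth_default // mul0r.
Qed.

(** A coefficient arriving in degree k + 1 carries a factor from [lam k], which [lam0] makes zero
    when k + 1 is outside [D]. *)
Lemma shift_supported x u : shift_poly x u \in supported D.
Proof.
apply/supportedP => -[|k] Dk; rewrite coef_shift // lam0 //.
by rewrite mxE mulr0.
Qed.

Definition shift x u : V := SuppPoly (shift_supported x u).

Lemma shift_linear x : linear (shift x).
Proof.
move=> c u v; apply/supp_polyP => -[|i].
  by rewrite -[supp_val (_ + _)]/(c *: val _ + val _) coefD coefZ !coef_shift mulr0 addr0.
rewrite -[supp_val (_ + _)]/(c *: val _ + val _) coefD coefZ !coef_shift.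
by rewrite -[supp_val (_ + _)]/(c *: val _ + val _) coefD coefZ mulrDl mulrA.
Qed.

HB.instance Definition _ x :=
  GRing.isLinear.Build F V V _ (shift x) (shift_linear x).

(** If i + 1 lies in [D], so does i, and both monomials are genuine powers of X; otherwise [lam i]
    is zero and both sides vanish. *)
Lemma shift_mon x i : shift x (supp_mon F D i) = lam i 0 x *: supp_mon F D i.+1.
Proof.
apply/supp_polyP => k; rewrite -[supp_val (_ *: _)]/(_ *: val _) coefZ.
rewrite [X in _ * X]coef_supp_mon coef_shift.
case: k => [|k]; first by rewrite andbF mulr0.
rewrite coef_supp_mon eqSS mulrC; case: eqP => [->|]; last by rewrite !andbF !mulr0.
case: (boolP (D i.+1)) => [/D_pred -> //|/lam0 ->].
by rewrite mxE !mul0r.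
Qed.

Lemma factor_rcons (y : nat -> 'I_m) s l :
  factor y s l.+1 = rcons (factor y s l) (y (s + l)%N).
Proof. by rewrite /factor -cats1 -addn1 iotaD map_cat. Qed.

(** A term of degree n in the image can only come from degree n minus the length of [w], through
    nonzero coordinates at every step. The word can therefore be read off a compatible [y]; the
    induction peels off its last letter. *)
Lemma word_act_coef w u n : (word_act shift w u)`_n != 0 ->
  exists (y : nat -> 'I_m) s,
  [/\ compatible y, n = (s + size w)%N & w = factor y s (size w)].
Proof.
elim/last_ind: w n => [|w x IHw] n.
  (* The empty word is a factor of any compatible word, at any position. *)
  by exists y0, n; rewrite addn0.
rewrite /word_act foldl_rcons -/(word_act shift w u) coef_shift.
case: n => [|n]; first by rewrite eqxx.
rewrite mulf_eq0 negb_or => /andP[/IHw [y [s [yP -> Ew]]] lx].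
(* The last letter [x] acts in degree s + size w, where its coordinate is nonzero, so overriding [y]
   there keeps it compatible. *)
exists (fun i => if i == (s + size w)%N then x else y i), s; split.
- by move=> i Di; case: (i =P _) => [->|_] //; apply: yP.
- by rewrite size_rcons addnS.
rewrite size_rcons factor_rcons eqxx {1}Ew; congr rcons.
apply/eq_in_map => i; rewrite mem_iota => /andP[_ /ltn_eqF -> //].
Qed.

(** A relation with a nonzero coefficient in its image would be a factor of a compatible word ending
    in a degree of [D], hence nonzero in the algebra, whereas relations are zero there. *)
Lemma shift_kill : words_kill shift S.
Proof.
move=> w Sw u; apply/supp_polyP => n; rewrite coef0.
apply/eqP/negPn/negP => wn.
have [y [s [yP En Ew]]] := word_act_coef wn.
have Dn : D n by apply: contraNT wn => Dn; rewrite supp_coef0.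
have := mono_compatible yP (s := s) (l := size w).
rewrite -En -Ew => /(_ Dn); have := mono_eq0 F Sw; case: (w) => w' /= ->.
by rewrite eqxx.
Qed.

Definition path_module : lmodType (monomial_alg F S)^c := word_module shift_kill.

Implicit Types (a : monomial_alg F S).

Definition path_comp n : set path_module :=
  [set u : V | forall i, i != n -> u`_i = 0].

Lemma path_comp0 n : path_comp n 0.
Proof. by move=> i _; rewrite coef0. Qed.

Lemma path_compD n u v : path_comp n u -> path_comp n v -> path_comp n (u + v).
Proof.
move=> un vn i ni; rewrite -[supp_val (_ + _)]/(val u + val v).
by rewrite coefD [_`_i]un ?[_`_i]vn ?addr0.
Qed.

Lemma path_compZ n (c : F) u : path_comp n u -> path_comp n (c *: u).
Proof.
move=> un i ni; rewrite -[supp_val (_ *: _)]/(c *: val u).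
by rewrite coefZ [_`_i]un ?mulr0.
Qed.

Lemma coef_supp_sum N (f : nat -> V) k :
  (\sum_(i < N) f i : V)`_k = \sum_(i < N) (f i)`_k.
Proof.
by rewrite -[supp_val (\sum_(i < _) _)]/(val _) linear_sum coef_sum.
Qed.

Lemma path_comp_mon n : path_comp n (supp_mon F D n).
Proof. by move=> i ni; rewrite coef_supp_mon (negPf ni) andbF. Qed.

(** No condition on n is needed: outside [D] both the coefficient and the monomial are zero. *)
Lemma path_comp_line n u : path_comp n u -> u = u`_n *: supp_mon F D n.
Proof.
move=> un; apply/supp_polyP => i; rewrite -[supp_val (_ *: _)]/(_ *: val _) coefZ.
rewrite [X in _ * X]coef_supp_mon; case: (eqVneq i n) => [->|ni].
  have [Dn|Dn] := boolP (D n); first by rewrite mulr1.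
  by rewrite supp_coef0 // mul0r.
by rewrite andbF mulr0; apply: un.
Qed.

Lemma path_comp_sum u : exists N (v : nat -> path_module),
  (forall i, path_comp i (v i)) /\ u = \sum_(i < N) v i.
Proof.
exists (size u), (fun i => u`_i *: supp_mon F D i : V); split; last exact: supp_polyE.
by move=> i; apply/path_compZ/path_comp_mon.
Qed.

(** In degree i only [v i] contributes to the sum, so its single coefficient is zero. *)
Lemma path_comp_direct N (v : nat -> path_module) :
  (forall i, path_comp i (v i)) -> \sum_(i < N) v i = 0 ->
  forall i, (i < N)%N -> v i = 0.
Proof.
move=> vP v0 i iN; rewrite [LHS](path_comp_line (vP i)).
have := coef_supp_sum N v i; rewrite [X in supp_val X]v0 coef0.
rewrite (bigD1 (Ordinal iN)) //= big1 ?addr0 => [<-|j ji].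
  by rewrite scale0r.
by apply: vP; rewrite eq_sym -val_eqE in ji *.
Qed.

Lemma path_comp_shift n x u : path_comp n u -> path_comp n.+1 (shift x u).
Proof.
by move=> un [|i] ni; rewrite coef_shift // [_`_i]un ?mul0r.
Qed.

Lemma path_comp_word n w u :
  path_comp n u -> path_comp (n + size w)%N (word_act shift w u).
Proof.
elim: w n u => [|x w IHw] n u un; first by rewrite addn0.
by rewrite /= -addSnnS; apply/IHw/path_comp_shift.
Qed.

Lemma path_comp_act n l u a :
  path_comp n u -> alg_comp F S l a -> path_comp (n + l)%N (ract (u : path_module) a).
Proof.
move=> un [f fl <-]; rewrite ract_proj /malg_act.
apply: (big_ind (path_comp (n + l)%N)).
- exact: path_comp0.
- by move=> ? ?; apply: path_compD.
(* Every word with a nonzero coefficient in [f] has length l. *)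
move=> k _; have [->|/fl <-] := eqVneq (f@_k) 0.
  by rewrite scale0r; apply: path_comp0.
exact/path_compZ/path_comp_word.
Qed.

Lemma path_comp_fscale n c (u : path_module) :
  path_comp n u -> path_comp n (fscale c u).
Proof. by rewrite fscaleE; apply: path_compZ. Qed.

Definition path_graded : graded_module F S :=
  GradedModule path_comp0 path_compD path_comp_fscale path_comp_sum
    path_comp_direct path_comp_act.

Definition path_basis i : path_module := supp_mon F D i.

Lemma path_basis_line i : D i -> spans_line (gm_comp path_graded i) (path_basis i).
Proof.
move=> Di; split.
  apply: contra_neq (oner_neq0 F) => bi0.
  by have := coef_supp_mon F D i i; rewrite [supp_mon _ _ _]bi0 coef0 Di eqxx.
apply/seteqP; split=> [u ui | _ [c _ <-]].
  by exists (u : V)`_i => //; rewrite fscaleE -path_comp_line.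
exact/path_comp_fscale/path_comp_mon.
Qed.

Lemma path_comp_eq0 i : ~~ D i -> gm_comp path_graded i = [set 0].
Proof.
move=> Di; apply/seteqP; split=> [u /path_comp_line -> | _ ->].
  by rewrite (supp_coef0 u) // scale0r.
exact: path_comp0.
Qed.

Lemma path_basis_gen i x :
  ract (path_basis i) (gen F S x) = fscale (lam i 0 x) (path_basis i.+1).
Proof. by rewrite ract_gen fscaleE [LHS]shift_mon. Qed.

(** Inside [D], the letter [y0 i] sends each basis vector to a nonzero multiple of the next, and
    that scalar can be inverted. Outside [D] the basis vector is zero. *)
Lemma path_basis_cyclic i :
  exists a : monomial_alg F S, path_basis i = ract (path_basis 0) a.
Proof.
have [Di|Di] := boolP (D i); last first.
  exists 0; rewrite /ract scale0r.
  by apply/supp_polyP => k; rewrite coef_supp_mon (negPf Di) coef0.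
elim: i Di => [|i IHi] Di; first by exists 1; rewrite ract1.
have [a Ea] := IHi (D_pred Di).
have /(fscale_inv (y0P Di)) := path_basis_gen i (y0 i).
by rewrite Ea -ractM /fscale -ractM => ->; eexists.
Qed.

Lemma path_cyclic : cyclic_deg0 path_graded.
Proof.
exists (path_basis 0); first exact: path_comp_mon.
move=> u; rewrite [u]supp_polyE.
apply: (big_ind (fun v : path_module => exists a, v = ract (path_basis 0) a)).
- by exists 0; rewrite /ract scale0r.
- by move=> _ _ [a ->] [b ->]; exists (a + b); rewrite [RHS]scalerDl.
move=> i _; have [a Ea] := path_basis_cyclic i.
(* The coefficient is absorbed into the algebra as a multiple of 1. *)
exists (a * (u`_i *: (1 : monomial_alg F S))); rewrite ractM -Ea.
by rewrite -[RHS]/(fscale _ _) fscaleE.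
Qed.

Lemma path_module_exists :
  exists (M : graded_module F S) (e : nat -> M),
  [/\ cyclic_deg0 M,
      forall i, D i -> spans_line (gm_comp M i) (e i),
      forall i, ~~ D i -> gm_comp M i = [set 0]
    & forall i x, ract (e i) (gen F S x) = fscale (lam i 0 x) (e i.+1)].
Proof.
exists path_graded, path_basis; split.
- exact: path_cyclic.
- exact: path_basis_line.
- exact: path_comp_eq0.
- exact: path_basis_gen.
Qed.

End PathModule.

(** * Points of coordinate subspaces and their homogeneous coordinates *)

Section Projective.
Variables (F : fieldType) (m : nat).

Lemma homog_coords_neq0 (p : proj_space F m) w : homog_coords p w -> w != 0.
Proof.
by move=> pw; have := valP p; rewrite pw dim_vline; case: (w =P 0).
Qed.

Lemma row_neq0_ex (w : 'rV[F]_m) : w != 0 -> exists j, w 0 j != 0.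
Proof.
move=> w0; apply/existsP; apply: contraNT w0 => /existsPn w0.
by apply/eqP/rowP => j; rewrite mxE; apply/eqP/negPn/w0.
Qed.

(** The coordinate point of any letter of [C] will do. *)
Lemma coord_subspace_ex (C : {set 'I_m}) : C != finset.set0 ->
  exists p, coord_subspace F C p.
Proof.
case/set0Pn => j Cj; have d1 : \dim <[delta_mx ord0 j : 'rV[F]_m]>%VS == 1%N.
  rewrite dim_vline; suff -> : (delta_mx ord0 j : 'rV[F]_m) != 0 by [].
  apply: contra_neq (oner_neq0 F) => /rowP/(_ j).
  by rewrite !mxE !eqxx.
exists (exist (fun L => \dim L == 1%N) _ d1), (delta_mx ord0 j) => // k Ck.
by rewrite mxE eqxx /=; case: eqP Ck => // ->; rewrite Cj.
Qed.

(** The index type is arbitrary so that the choice of coordinates covers both infinite sequences and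
    sequences of length n + 1. *)
Lemma coord_subspace_rows (I : Type) (C : I -> {set 'I_m})
    (p : I -> proj_space F m) : (forall k, coord_subspace F (C k) (p k)) ->
  exists lam : I -> 'rV[F]_m,
  [/\ forall k, homog_coords (p k) (lam k),
      forall k, exists j, lam k 0 j != 0
    & forall k j, lam k 0 j != 0 -> j \in C k].
Proof.
move=> pC.
have /choice[lam lamP] : forall k, exists w, homog_coords (p k) w /\
    forall j, j \notin C k -> w 0 j = 0.
  by move=> k; have [w] := pC k; exists w.
exists lam; split=> [k|k|k j]; first exact: (lamP k).1.
  exact/row_neq0_ex/homog_coords_neq0/(lamP k).1.
by apply: contraNT => /(lamP k).2 ->.
Qed.

End Projective.

(** * Point modules and truncated point modules in terms of supports *)

Section PointModuleDescription.
Variables (F : fieldType) (m : nat) (S : set {fmonom 'I_m}).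

Lemma limP_tree (p : nat -> proj_space F m) : limP F S p <->
  exists2 C, is_tree F S C & forall k, coord_subspace F (C k) (p k).
Proof.
split=> [[M [_ [e [lam [eP lamP plam]]]]]|[C [C0 TC] pC]].
  exists (fun k => [set j | lam k 0 j != 0]%SET); last first.
    move=> k; exists (lam k) => // j; rewrite inE negbK => /eqP //.
  split=> [k|y yC s l].
    have [j lj] := row_neq0_ex (homog_coords_neq0 (plam k)).
    by apply/set0Pn; exists j; rewrite inE.
  apply: (@path_neq0 _ _ _ M xpredT e lam) => //.
  - by move=> i _; have := yC i; rewrite inE.
  - by case: (eP (s + l)%N).
have [lam [plam lam_neq0 lamC]] := coord_subspace_rows pC.
have [y0 y0P] := choice lam_neq0.
have lam0 i : ~~ xpredT i.+1 -> lam i = 0 by [].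
have y0c : compatible xpredT lam y0 by move=> i _; apply: y0P.
(* A compatible word uses only letters from the supports of the rows, so it is a word of the
   tree. *)
have mono_y y : compatible xpredT lam y ->
    forall s l, xpredT (s + l)%N -> mono F S (factor y s l) != 0.
  by move=> yP s l _; apply: TC => i; apply/lamC/yP.
have [//|M [e [cM eP _ e_gen]]] := path_module_exists _ lam0 y0c mono_y.
exists M; split; first by split=> // k; exists (e k); apply: eP.
by exists e, lam; split=> [i|i j|i]; [apply: eP | apply: e_gen | exact: plam].
Qed.

Lemma truncP_tree n (p : 'I_n.+1 -> proj_space F m) : truncP F S n p <->
  exists2 C, is_tree F S C & forall k : 'I_n.+1, coord_subspace F (C k) (p k).
Proof.
split=> [[q /limP_tree[C TC qC] <-]|[C TC pC]]; first by exists C.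
have [q0 q0C] := choice (fun k => coord_subspace_ex F (TC.1 k)).
(* The given point is prolonged beyond index n by arbitrary points of the later coordinate
   subspaces. *)
exists (fun k => if (k < n.+1)%N then p (inord k) else q0 k).
  apply/limP_tree; exists C => // k; case: ifP => // kn.
  by have := pC (inord k); rewrite inordK.
by apply/funext => k; rewrite ltn_ord inord_val.
Qed.

Lemma barP_nonzero_product n (p : 'I_n.+1 -> proj_space F m) : barP F S n p <->
  exists2 C, nonzero_product F S C & forall k, coord_subspace F (C k) (p k).
Proof.
split=> [[M [_ [e [lam [eP lamP plam]]]]]|[C [C0 TC] pC]].
  exists (fun k => [set j | lam k 0 j != 0]%SET); last first.
    by move=> k; exists (lam k) => // j; rewrite inE negbK => /eqP.
  split=> [k|w wC].
    have [j lj] := row_neq0_ex (homog_coords_neq0 (plam k)).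
    by apply/set0Pn; exists j; rewrite inE.
  (* The tuple is read as the first n + 1 letters of an infinite word; the values of [inord] beyond
     n do not enter. *)
  have -> : tval w = factor (fun i => tnth w (inord i)) 0 n.+1.
    rewrite -[in LHS](map_tnth_enum w) /factor -val_enum_ord -map_comp.
    by apply: eq_map => i /=; rewrite inord_val.
  apply: (@path_neq0 _ _ _ M (fun i => i <= n.+1)%N e (fun i => lam (inord i))).
  - by move=> i j Di; have := lamP (inord i) j; rewrite inordK.
  - by move=> i _; have := wC (inord i); rewrite inE.
  - by [].
  - by case: (eP (0 + n.+1)%N).
have [lam0 [plam lam_neq0 lamC]] := coord_subspace_rows pC.
have [y0 y0P] := choice lam_neq0.
pose D i := (i <= n.+1)%N.
(* The rows are set to zero from index n + 1 on, so that e_(n+1) is killed by every letter. *)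
pose lam i := if D i.+1 then lam0 (inord i) else 0.
have lam_eq0 i : ~~ D i.+1 -> lam i = 0 by rewrite /lam => /negPf ->.
have y0c : compatible D lam (fun i => y0 (inord i)).
  by move=> i Di; rewrite /lam Di.
have mono_y y : compatible D lam y ->
    forall s l, D (s + l)%N -> mono F S (factor y s l) != 0.
  move=> yP s l Dsl; pose w := [tuple y k | k < n.+1].
  have /TC : forall k, tnth w k \in C k.
    move=> k; rewrite tnth_mktuple; apply: lamC.
    by have := yP k (ltn_ord k); rewrite /lam /D ltn_ord inord_val.
  (* The hypothesis concerns words of length exactly n + 1, so the factor is completed on both sides
     to the first n + 1 letters of [y]. *)
  have -> : tval w = factor y 0 s ++ factor y s l ++ factor y (s + l) (n.+1 - (s + l)).
    rewrite /factor -!map_cat -iotaD -[X in iota X (l + _)]add0n -iotaD.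
    rewrite addnA subnKC //.
    by rewrite -val_enum_ord -map_comp -val_ord_tuple.
  exact: mono_infix.
have [i|M [e [cM eP e0 e_gen]]] := path_module_exists _ lam_eq0 y0c mono_y.
  exact: ltnW.
exists M; split.
  split=> // k; first by exists (e k); apply: eP.
  by rewrite ltnNge; apply: e0.
exists e, lam0; split=> [i|i j|i]; [exact: eP | | exact: plam].
by rewrite e_gen /lam /D ltn_ord inord_val.
Qed.

End PointModuleDescription.

Theorem theorem6p8 (F : fieldType) (m : nat) (hm : (2 <= m)%N)
    (S : set {fmonom 'I_m}) :
  [/\ limP F S =
        \bigcup_(C in is_tree F S)
          [set p : nat -> proj_space F m |
            forall k, coord_subspace F (C k) (p k)],
      forall n : nat,
        truncP F S n =
          \bigcup_(C in is_tree F S)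
            [set p : 'I_n.+1 -> proj_space F m |
              forall k : 'I_n.+1, coord_subspace F (C k) (p k)]
    & forall n : nat,
        barP F S n =
          \bigcup_(C in nonzero_product F S (n := n))
            [set p : 'I_n.+1 -> proj_space F m |
              forall k : 'I_n.+1, coord_subspace F (C k) (p k)]].
Proof.
split=> [|n|n]; apply/seteqP; split=> p.
- by move=> /limP_tree[C ? ?]; exists C.
- by move=> [C ? ?]; apply/limP_tree; exists C.
- by move=> /truncP_tree[C ? ?]; exists C.
- by move=> [C ? ?]; apply/truncP_tree; exists C.
- by move=> /barP_nonzero_product[C ? ?]; exists C.
- by move=> [C ? ?]; apply/barP_nonzero_product; exists C.
Qed.
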